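(* Let $p$ be a monic real-rooted polynomial of degree $d$, and let $\alpha\in\mathbb{R}$, $\alpha\neq 0$. Then the function $t\mapsto \mathrm{Dis}(p-t\alpha p')$ is decreasing for $t<0$ and increasing for $t>0$. In particular, it has a global minimum at $t=0$. In particular, for all $\alpha\in\mathbb{R}\setminus\{0\}$, $$\mathrm{Dis}(p-\alpha p')>\mathrm{Dis}(p).$$
   Context: For a monic polynomial $p(x)=\prod_{i=1}^d(x-\lambda_i)$ of degree $d$, the discriminant is $\mathrm{Dis}(p)=\prod_{i<j}(\lambda_i-\lambda_j)^2$. A polynomial is real-rooted if all its roots are real. $p'$ denotes the derivative of $p$.
   Formalization: The strict claims (strictly decreasing/increasing, Dis(p-αp')>Dis(p)) are stated for d≥2 and roots of p of multiplicity at most 2, since otherwise the discriminant is constant in t (e.g. p=x^3); for all other p only weak monotonicity and the minimum at t=0 are claimed. *)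

(* Defs.v *)
From mathcomp Require Import all_boot all_order all_algebra.
From mathcomp Require Import reals.
From mathcomp Require Import complex.
Set Implicit Arguments.
Unset Strict Implicit.
Unset Printing Implicit Defensive.
Import Order.TTheory GRing.Theory Num.Theory.
Local Open Scope ring_scope.
Local Open Scope complex_scope.

Definition vdm_sqr (K : nzRingType) (s : seq K) : K :=
  \prod_(j < size s) \prod_(i < size s | (i < j)%N) (s`_i - s`_j) ^+ 2.

Section Discriminant.
Variable R : realType.
Implicit Types (p : {poly R}) (s : seq R).

Definition complexify p : {poly R[i]} := map_poly (real_complex R) p.

(* Listed with multiplicity, in an unspecified order. *)
Definition complex_roots p : seq R[i] :=
  sval (closed_field_poly_normal (complexify p)).

Definition real_rooted p : Prop :=
  forall z : R[i], root (complexify p) z -> complex.Im z = 0.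

(* The product over the complex roots of a real polynomial is a real number   *)
(* ([DisC] below), so that taking the real part loses nothing. The leading    *)
(* coefficient does not enter: this is the discriminant of monic polynomials. *)
Definition Dis p : R := complex.Re (vdm_sqr (complex_roots p)).

End Discriminant.

Lemma vdm_sqr_cons (K : comNzRingType) (x : K) s :
  vdm_sqr (x :: s) = (\prod_(y <- s) (x - y) ^+ 2) * vdm_sqr s.
Proof.
rewrite /vdm_sqr /= big_ord_recl big1 ?mul1r; last by move=> i; rewrite ltn0.
rewrite [in RHS](big_nth 0) big_mkord -big_split /=.
apply: eq_bigr => j _; rewrite big_mkcond big_ord_recl /=; congr (_ * _).
by rewrite [RHS]big_mkcond /=; apply: eq_bigr => i _; rewrite /bump /= !add1n ltnS.
Qed.

Lemma vdm_sqr_rem (K : comNzRingType) (x : K) s : x \in s ->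
  vdm_sqr s = (\prod_(y <- rem x s) (x - y) ^+ 2) * vdm_sqr (rem x s).
Proof.
elim: s => [//|y s IHs]; rewrite inE /=; case: (eqVneq x y) => [-> _|nxy /= xs].
  by rewrite vdm_sqr_cons.
rewrite !vdm_sqr_cons IHs // (perm_big _ (perm_to_rem xs)) !big_cons.
rewrite -[(x - y) ^+ 2]sqrrN opprB; exact: mulrACA.
Qed.

Lemma perm_vdm_sqr (K : comNzRingType) (s t : seq K) :
  perm_eq s t -> vdm_sqr s = vdm_sqr t.
Proof.
elim: s t => [|x s IHs] t.
  by rewrite perm_sym => /perm_nilP ->.
move=> st; have xt : x \in t by rewrite -(perm_mem st) mem_head.
have sr : perm_eq s (rem x t).
  by rewrite -(perm_cons x) (perm_trans st) // perm_to_rem.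
by rewrite vdm_sqr_cons (vdm_sqr_rem xt) (IHs _ sr) (perm_big _ sr).
Qed.

Lemma vdm_sqr_map (K L : comNzRingType) (f : {rmorphism K -> L}) s :
  vdm_sqr [seq f x | x <- s] = f (vdm_sqr s).
Proof.
elim: s => [|x s IHs] /=; first by rewrite /vdm_sqr !big_ord0 rmorph1.
rewrite !vdm_sqr_cons IHs rmorphM rmorph_prod big_map; congr (_ * _).
by apply: eq_bigr => y _; rewrite rmorphXn rmorphB.
Qed.

Lemma complex_rootsE (R : realType) (p : {poly R}) : p \is monic ->
  complexify p = \prod_(z <- complex_roots p) ('X - z%:P).
Proof.
move=> mp; rewrite /complex_roots; case: closed_field_poly_normal => s /= {1}->.
by rewrite (monicP _) ?scale1r // /complexify map_monic.
Qed.

Lemma DisC (R : realType) (p : {poly R}) : p \is monic ->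
  (Dis p)%:C = vdm_sqr (complex_roots p).
Proof.
move=> mp; have e := complex_rootsE mp.
have : vdm_sqr (complex_roots p) = (vdm_sqr (complex_roots p))^*.
  rewrite -[RHS](vdm_sqr_map (@conjc R)); apply: perm_vdm_sqr.
  apply: prod_XsubC_eq; rewrite -e big_map.
  have -> : complexify p = map_poly (@conjc R) (complexify p).
    rewrite /complexify -map_poly_comp; apply: eq_map_poly => x /=.
    by rewrite oppr0.
  rewrite e rmorph_prod; apply: eq_bigr => z _.
  by rewrite rmorphB /= map_polyX map_polyC.
rewrite /Dis; case: (vdm_sqr _) => a b [] /eqP.
by rewrite -addr_eq0 -mulr2n mulrn_eq0 /= => /eqP ->.
Qed.

Lemma Dis_real_roots (R : realType) (s : seq R) :
  Dis (\prod_(x <- s) ('X - x%:P)) = vdm_sqr s.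
Proof.
have mp := monic_prod_XsubC s predT id.
apply: complexI; rewrite DisC // -(vdm_sqr_map (real_complex R)).
apply: perm_vdm_sqr; apply: prod_XsubC_eq; rewrite -complex_rootsE //.
rewrite /complexify rmorph_prod big_map; apply: eq_bigr => x _.
by rewrite rmorphB /= map_polyX map_polyC.
Qed.

(* Main.v *)
Require Import Defs.
From mathcomp Require Import all_boot all_order all_algebra.
From mathcomp Require Import reals.
From mathcomp Require Import complex polyorder polyrcf ring.
From mathcomp Require Import fingroup perm mpoly.
Import Order.TTheory GRing.Theory Num.Theory.
Local Open Scope ring_scope.

Set Implicit Arguments.
Unset Strict Implicit.
Unset Printing Implicit Defensive.

(** Let [d >= 2] (otherwise all the discriminants are 1) and write
[q = p - t p'] for real [t <> 0]. Since [p'/p] is never real off the real axis,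
[q] is real-rooted, and its roots [x_1, ..., x_d] are distinct unless [p] has a
root of multiplicity at least 3, in which case all the discriminants vanish.

Moving [t] moves the root [x_i] with velocity [w_i = p'(x_i) / q'(x_i)], so the
logarithmic derivative of the discriminant is

  [sum_(i < j) 2 (w_i - w_j) / (x_i - x_j) = sum_i w_i q''(x_i) / q'(x_i)],

because [q'' / q'] at [x_i] is twice the sum of the [1 / (x_i - x_j)]. The [w_i]
are the residues of [p'/q], so they add up to [d]. The crux is the pointwise
inequality

  [t w_i q''(x_i) / q'(x_i) > w_i - 1],

in which, after clearing [q'^2], everything cancels except [p' p''' < p''^2] at
[x_i]: the Laguerre inequality for the real-rooted polynomial [p']
([laguerre_deriv_gt0], [weighted_log_deriv_gt]). Summing over [i] shows that [t]
times the derivative of the discriminant is positive ([Dis_pencil_poly]), and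
the mean value theorem concludes.

Derivatives of the roots are never taken. The discriminant is a polynomial in
the coefficients ([discriminant_of_coefs]), so its first variation can be
computed on any family of monic polynomials with the same first-order behaviour
as the pencil; the family whose roots are [x_i + w_i (T - t)] is one, by
Lagrange interpolation ([discriminant_of_pencil]). *)

Local Notation prodX s := (\prod_(x <- s) ('X - x%:P)).

(** * Squared Vandermonde products *)

Lemma vdm_sqr_eq0 (F : fieldType) (s : seq F) : (vdm_sqr s == 0) = ~~ uniq s.
Proof.
elim: s => [|x s IHs]; first by rewrite /vdm_sqr big_ord0 oner_eq0.
rewrite vdm_sqr_cons mulf_eq0 IHs /= negb_and negbK; congr (_ || _).
rewrite prodf_seq_eq0 -has_pred1; apply: eq_has => y /=.
by rewrite sqrf_eq0 subr_eq0 eq_sym.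
Qed.

Lemma vdm_sqr_ge0 (F : realDomainType) (s : seq F) : 0 <= vdm_sqr s.
Proof.
by apply: prodr_ge0 => j _; apply: prodr_ge0 => i _; apply: sqr_ge0.
Qed.

Lemma vdm_sqr_gt0 (F : realFieldType) (s : seq F) : uniq s -> 0 < vdm_sqr s.
Proof. by move=> us; rewrite lt0r vdm_sqr_ge0 vdm_sqr_eq0 us. Qed.

(** * The Laguerre inequality *)

Lemma derivCXsubC (F : nzRingType) (a : F) (g : {poly F}) :
  (('X - a%:P) * g)^`() = g + ('X - a%:P) * g^`().
Proof. by rewrite derivM derivXsubC mul1r. Qed.

(** Splitting off one root expresses [f'^2 - f f''] as a square plus a
nonnegative multiple of the same quantity for the cofactor. For a real-rooted
[f] with roots [nu_i] that quantity is [f^2 * sum_i 1 / (x - nu_i)^2] off the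
roots; the recursion also covers the roots. *)
Lemma laguerre_XsubC_mul (F : comNzRingType) (a x : F) (g : {poly F}) :
  let N f := f^`().[x] ^+ 2 - f.[x] * f^`()^`().[x] in
  N (('X - a%:P) * g) = g.[x] ^+ 2 + (x - a) ^+ 2 * N g.
Proof.
rewrite /= !derivCXsubC derivD derivCXsubC.
rewrite !hornerD !hornerM !hornerXsubC; ring.
Qed.

Lemma laguerre_ge0 (F : realFieldType) (s : seq F) (x : F) :
  (prodX s).[x] * (prodX s)^`()^`().[x] <= (prodX s)^`().[x] ^+ 2.
Proof.
elim: s => [|a s IHs]; rewrite ?big_nil ?derivC ?hornerE ?expr0n //=.
rewrite -subr_ge0 big_cons laguerre_XsubC_mul addr_ge0 ?sqr_ge0 //.
by rewrite mulr_ge0 ?sqr_ge0 ?subr_ge0.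
Qed.

(** Strictness fails only at multiple roots: where [f] does not vanish, the
cofactor of any root contributes a positive square. *)
Lemma laguerre_gt0 (F : realFieldType) (s : seq F) (x : F) : (0 < size s)%N ->
    ((prodX s).[x] != 0) || ((prodX s)^`().[x] != 0) ->
  (prodX s).[x] * (prodX s)^`()^`().[x] < (prodX s)^`().[x] ^+ 2.
Proof.
case: s => // a s _; have [-> /= d0|nz _] := eqVneq.
  by rewrite mul0r exprn_even_gt0.
rewrite -subr_gt0 big_cons laguerre_XsubC_mul ltr_wpDr //.
  by rewrite mulr_ge0 ?sqr_ge0 ?subr_ge0 ?laguerre_ge0.
rewrite exprn_even_gt0 //=; apply: contraNneq nz => g0.
by rewrite big_cons hornerM g0 mulr0.
Qed.

(** * Real-rootedness of the pencil *)

Lemma real_rooted_split (R : realType) (p : {poly R}) :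
  p \is monic -> real_rooted p -> exists s, p = prodX s.
Proof.
move=> mp rp; exists (map (@complex.Re R) (complex_roots p)).
have e := complex_rootsE mp.
apply: (map_poly_inj (real_complex R)).
rewrite rmorph_prod big_map -/(complexify p) [LHS]e big_seq [RHS]big_seq.
apply: eq_bigr => z zp; rewrite rmorphB /= map_polyX map_polyC /=.
have : complex.Im z = 0 by apply: rp; rewrite e root_prod_XsubC.
by case: z {zp} => a b /= ->.
Qed.

Lemma log_deriv (F : fieldType) (s : seq F) (z : F) : (prodX s).[z] != 0 ->
  (prodX s)^`().[z] = (prodX s).[z] * \sum_(x <- s) (z - x)^-1.
Proof.
elim: s => [|a s IHs]; first by rewrite !big_nil derivC !hornerE.
rewrite !big_cons derivCXsubC !hornerE mulf_eq0 negb_or => /andP[za gz].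
by rewrite IHs //; field.
Qed.

(** Off the real axis, [Im (p'/p)(z) = - Im z * sum_i 1 / |z - x_i|^2] is
nonzero, so [p'/p] cannot take the real value [a / b] there. The case [a = 0]
is the real-rootedness of the derivative. *)
Lemma real_rooted_pencil (R : realType) (s : seq R) (a b : R) :
  (0 < size s)%N -> (a != 0) || (b != 0) ->
  real_rooted (a *: prodX s - b *: (prodX s)^`()).
Proof.
move=> s0 ab z; have [//|nz] := eqVneq (complex.Im z) 0.
pose S := \sum_(x <- s) (z - (x%:C)%C)^-1.
have ImS : complex.Im S = - complex.Im z *
    \sum_(x <- s) ((complex.Re z - x) ^+ 2 + complex.Im z ^+ 2)^-1.
  rewrite /S raddf_sum mulr_sumr; apply: eq_bigr => x _.
  by case: (z) => u v /=; rewrite !subr0 mulNr.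
have Imn : complex.Im S != 0.
  rewrite ImS mulf_neq0 ?oppr_eq0 //; apply: lt0r_neq0.
  case: s s0 {S ImS} => // x s _; rewrite big_cons ltr_pwDl //.
    by rewrite invr_gt0 ltr_wpDl ?sqr_ge0 // exprn_even_gt0.
  by apply: sumr_ge0 => y _; rewrite invr_ge0 addr_ge0 ?sqr_ge0.
have eP : complexify (prodX s) = prodX (map (real_complex R) s).
  rewrite /complexify rmorph_prod big_map; apply: eq_bigr => x _.
  by rewrite rmorphB /= map_polyX map_polyC.
have Pz : (complexify (prodX s)).[z] != 0.
  rewrite -/(root _ z) eP root_prod_XsubC; apply: contraNN nz.
  by case/mapP => x _ ->.
rewrite /root /complexify rmorphB /= !map_polyZ -deriv_map -/(complexify _).
rewrite !hornerE eP log_deriv -?eP // big_map -/S.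
rewrite [X in X - _]mulrC [X in _ - X]mulrCA -mulrBr.
rewrite mulf_eq0 (negPf Pz) /= => /eqP.
case: (S) Imn => u v /= vn [/eqP + /eqP]; rewrite !mul0r subr0 addr0 sub0r oppr_eq0.
rewrite mulf_eq0 (negPf vn) orbF => + /eqP b0.
by rewrite b0 mul0r subr0 => /eqP a0; rewrite a0 b0 eqxx in ab.
Qed.

(** * The discriminant as a polynomial in the coefficients *)

Lemma dvdp_meval_sub (F : fieldType) n (M : {poly F}) (f : {mpoly {poly F}[n]})
    (u v : 'I_n -> {poly F}) :
  (forall i, M %| u i - v i) -> M %| f.@[u] - f.@[v].
Proof.
move=> uv.
have eqM (a b c e : {poly F}) : M %| a - b -> M %| c - e -> M %| a * c - b * e.
  move=> ab ce; have -> : a * c - b * e = (a - b) * c + b * (c - e) by ring.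
  by apply: dvdp_add; [rewrite dvdp_mulr | rewrite dvdp_mull].
rewrite !mevalE -sumrB.
apply: (big_ind (fun a => M %| a)) => [|a b|m _].
- exact: dvdp0.
- exact: dvdp_add.
rewrite -mulrBr dvdp_mull //.
apply: (big_ind2 (fun a b => M %| a - b)) => [|a b c e|i _].
- by rewrite subrr dvdp0.
- exact: eqM.
elim: (m i) => [|k IHk]; first by rewrite subrr dvdp0.
by rewrite !exprS eqM.
Qed.

(** The squared Vandermonde product of the variables is a symmetric polynomial,
hence a polynomial in the elementary symmetric ones, which are the coefficients
of [prodX s] up to sign. The ring [A] is not assumed to be a field because the
roots will themselves be polynomials in the pencil parameter. *)
Lemma discriminant_of_coefs (A : idomainType) n :
  exists f : {mpoly A[n]}, forall s : seq A, size s = n ->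
    vdm_sqr s = f.@[fun i => (-1) ^+ i.+1 * (prodX s)`_(n - i.+1)].
Proof.
pose V : seq {mpoly A[n]} := [seq 'X_i | i <- enum 'I_n].
have symV : vdm_sqr V \is symmetric.
  apply/issymP => g; rewrite -(vdm_sqr_map (msym g)); apply: perm_vdm_sqr.
  rewrite -map_comp (eq_map (g := fun i => 'X_(g i))); last first.
    by move=> i /=; rewrite [LHS]mmapX mmap1U.
  rewrite (map_comp (fun i => 'X_i) g); apply: perm_map.
  apply: uniq_perm; rewrite ?(map_inj_uniq perm_inj) ?enum_uniq // => i.
  rewrite mem_enum; apply/mapP; exists (g^-1%g i); rewrite ?mem_enum //.
  by rewrite permKV.
have [f [ef _]] := sym_fundamental symV.
exists f => s sn; have st : size s == n by apply/eqP.
pose t := Tuple st.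
have -> : vdm_sqr s = (vdm_sqr V).@[tnth t].
  rewrite -(vdm_sqr_map (meval (tnth t))); congr vdm_sqr.
  rewrite -map_comp -[LHS]/(tval t) -[in LHS](map_tnth_enum t).
  by apply: eq_map => i /=; rewrite mevalXU.
rewrite -ef comp_mpoly_meval; apply: meval_eq => i.
rewrite tnth_mktuple -/(prodX t).
have := mroots_coeff t (lift ord0 i); rewrite lift0 => ->.
by rewrite mulrA -exprMn mulN1r opprK expr1n mul1r.
Qed.

(** The parameter of the pencil is the variable ['X] of [{poly F}]: each root
moves with velocity [w x] and passes through [x] at time [t]. *)
Definition first_order (F : fieldType) (t : F) (w : F -> F) (s : seq F) :=
  [seq x%:P + w x *: ('X - t%:P) | x <- s].

(** The first-order term [g] is [sum_x w x * prod_(y != x) ('X - y)]. Its values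
at the roots are what identifies it later; its coefficient of degree
[(size s).-1] is the total velocity. *)
Lemma prod_first_order (F : fieldType) (t : F) (w : F -> F) (s : seq F) :
  exists (g : {poly F}) (r : {poly {poly F}}),
  [/\ prodX (first_order t w s) =
        (prodX s)^:P - ('X - t%:P)%:P * g^:P + (('X - t%:P) ^+ 2)%:P * r,
      (size g <= size s)%N,
      g`_(size s).-1 = \sum_(x <- s) w x &
      forall x, x \in s -> g.[x] = w x * (prodX s)^`().[x]].
Proof.
elim: s => [|a s [g [r [e sg cg vg]]]].
  exists 0, 0; rewrite /first_order /= !big_nil size_poly0 coef0; split=> //.
  by rewrite !rmorph0 !mulr0 subr0 addr0 rmorph1.
exists (w a *: prodX s + ('X - a%:P) * g).
exists (('X - (a%:P + w a *: ('X - t%:P))%:P) * r + (w a)%:P%:P * g^:P).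
split.
- rewrite /= !big_cons e !(rmorphD, rmorphM, rmorphN, rmorphB) /=.
  rewrite map_polyX map_polyC /= -!mul_polyC.
  rewrite !(rmorphD, rmorphM, rmorphN, rmorphB) /= !map_polyC /=; ring.
- rewrite (leq_trans (size_polyD _ _)) // geq_max.
  rewrite (leq_trans (size_scale_leq _ _)) ?size_prod_XsubC //=.
  by rewrite (leq_trans (size_polyMleq _ _)) // size_XsubC.
- rewrite big_cons /= coefD coefZ mulrBl coefB coefXM coefCM.
  have -> : (prodX s)`_(size s) = 1.
    have /monicP := monic_prod_XsubC s predT id.
    by rewrite lead_coefE size_prod_XsubC.
  rewrite mulr1 [g`_(size s)]nth_default // mulr0 subr0; congr (_ + _).
  case: s sg cg {e vg} => //= sg _; by rewrite big_nil.
move=> x; rewrite big_cons derivM derivXsubC mul1r !hornerE inE.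
have [-> _|xa /= xs] := eqVneq x a; first by rewrite subrr !mul0r !addr0.
have /eqP-> : root (prodX s) x by rewrite root_prod_XsubC.
rewrite vg //; ring.
Qed.

(** Lagrange interpolation: the velocities [g / (prodX s)'] make the roots
follow the pencil [prodX s - (T - t) g] to first order at [T = t]. They are the
residues of [g / prodX s]. *)
Lemma prod_first_order_interpolate (F : fieldType) (t : F) (g : {poly F})
    (s : seq F) (w := fun x => g.[x] / (prodX s)^`().[x]) :
  uniq s -> (size g <= size s)%N ->
  (forall x, x \in s -> (prodX s)^`().[x] != 0) ->
  \sum_(x <- s) w x = g`_(size s).-1 /\
  exists r : {poly {poly F}}, prodX (first_order t w s) =
    (prodX s)^:P - ('X - t%:P)%:P * g^:P + (('X - t%:P) ^+ 2)%:P * r.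
Proof.
move=> us sg ds; have [h [r [e sh ch vh]]] := prod_first_order t w s.
suff gh : g = h by rewrite gh; split=> //; exists r.
apply/eqP; rewrite -subr_eq0; apply/eqP.
apply: (roots_geq_poly_eq0 (rs := s)) => //; last first.
  by rewrite (leq_trans (size_polyD _ _)) // geq_max size_polyN sg.
apply/allP => x xs; rewrite /root !hornerE vh // /w divfK ?subrr //.
exact: ds.
Qed.

(** Logarithmic derivative of the discriminant along moving roots. Summing over
ordered pairs, the contribution [2 (w x - w y) / (x - y)] of an unordered pair
is shared between its two members. *)
Lemma vdm_sqr_first_order (F : fieldType) (t : F) (w : F -> F) (s : seq F) :
  uniq s ->
  let v := vdm_sqr (first_order t w s) in
  v.[t] = vdm_sqr s /\
  v^`().[t] = vdm_sqr s *
    \sum_(x <- s) w x * (\sum_(y <- s | y != x) 2 / (x - y)).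
Proof.
elim: s => [_|a s IHs /= /andP[as_ us]].
  by rewrite /vdm_sqr /= !big_ord0 big_nil derivC !hornerE.
have [v0 v1] := IHs us.
rewrite [first_order _ _ _]/= !vdm_sqr_cons; set P := \prod_(y <- _) _.
have [P0 P1] : P.[t] = \prod_(y <- s) (a - y) ^+ 2 /\
    P^`().[t] = \prod_(y <- s) (a - y) ^+ 2 *
      (\sum_(y <- s) (w a - w y) * (2 / (a - y))).
  rewrite /P big_map; elim: (s) as_ => [|b s' IH].
    by rewrite !big_nil derivC !hornerE.
  rewrite inE negb_or => /andP[ab /IH[Q0 Q1]].
  rewrite !big_cons derivM !hornerE Q0 Q1 expr2 derivM.
  rewrite !(derivD, derivN, derivZ, derivB, derivC, derivX) !hornerE.
  rewrite subrr !mulr0 !addr0; split; first by rewrite expr2.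
  have : a - b != 0 by rewrite subr_eq0.
  by move=> ? /=; field.
split; first by rewrite hornerM P0 v0.
rewrite derivM hornerD !hornerM P0 v0 P1 v1.
set A := \prod_(y <- s) _; set S1 := \sum_(y <- s) _; set S2 := \sum_(x <- s) _.
rewrite (_ : _ + _ = A * vdm_sqr s * (S1 + S2)); last by rewrite /=; ring.
congr (_ * _); rewrite /S1 /S2 big_cons big_cons eqxx /=.
have -> : \sum_(y <- s | y != a) 2 / (a - y) = \sum_(y <- s) 2 / (a - y).
  rewrite big_seq_cond [RHS]big_seq; apply: eq_bigl => y.
  by case: eqP => [->|]; rewrite ?andbT // (negPf as_).
rewrite mulr_sumr [X in _ = _ + X](_ : _ =
    \sum_(x <- s) - (w x * (2 / (a - x))) + S2); last first.
  rewrite /S2 -big_split /= big_seq [RHS]big_seq; apply: eq_bigr => x xs.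
  rewrite big_cons (_ : a != x); last by apply: contraNneq as_ => ->.
  by rewrite mulrDr -(opprB a x) invrN !mulrN.
rewrite addrA; congr (_ + _); rewrite -big_split /=; apply: eq_bigr => y _.
by rewrite mulrBl.
Qed.

(** * First variation of the discriminant along a pencil *)

Lemma uniq_simple_roots (F : fieldType) (s : seq F) :
  uniq s = all (fun x => (prodX s)^`().[x] != 0) s.
Proof.
elim: s => //= a s ->; rewrite big_cons derivCXsubC !hornerE subrr mul0r addr0.
rewrite -/(root _ a) root_prod_XsubC; have [//|as_] := boolP (a \in s).
apply: eq_in_all => x xs; rewrite !hornerE.
have /eqP-> : root (prodX s) x by rewrite root_prod_XsubC.
rewrite add0r mulf_eq0 subr_eq0 negb_or.
by rewrite (_ : x != a) //; apply: contraNneq as_ => <-.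
Qed.

(** Writing [prodX s = ('X - x) g], the second derivative at [x] is [2 g'(x)] and
the first is [g(x)]. *)
Lemma sum_inv_gaps (F : fieldType) (s : seq F) (x : F) : uniq s -> x \in s ->
  \sum_(y <- s | y != x) 2 / (x - y) =
  (prodX s)^`()^`().[x] / (prodX s)^`().[x].
Proof.
move=> us xs; rewrite (perm_big _ (perm_to_rem xs)) big_cons eqxx /=.
have xr : x \notin rem x s by rewrite mem_rem_uniq // inE eqxx.
have gx : (prodX (rem x s)).[x] != 0.
  by rewrite -/(root _ x) root_prod_XsubC.
rewrite [in RHS](perm_big _ (perm_to_rem xs)) big_cons /=.
rewrite !derivCXsubC derivD derivCXsubC.
rewrite !hornerD !hornerM !hornerXsubC subrr !mul0r !addr0 log_deriv //.
rewrite -mulrDr mulrAC divff // mul1r -big_split big_seq_cond [RHS]big_seq /=.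
apply: eq_big => y; last by move=> _; rewrite mulrDl mul1r.
by case: eqP => [->|]; rewrite ?andbT // (negPf xr).
Qed.

(** The polynomial [D] is the universal discriminant evaluated at the
coefficients of [p - T g]. Modulo [T - t] these coefficients are those of
[prodX s], and modulo [(T - t)^2] they are those of the product with moving
roots; since evaluation of a polynomial respects congruences, the first fact
gives the value of [D] at [t] and the second its derivative. *)
Lemma discriminant_of_pencil (F : fieldType) (p g : {poly F}) n :
  (size g <= n)%N ->
  exists D : {poly F}, forall (t : F) (s : seq F),
    size s = n -> p - t *: g = prodX s ->
    D.[t] = vdm_sqr s /\
    (uniq s -> let w x := g.[x] / (prodX s)^`().[x] in
      \sum_(x <- s) w x = g`_n.-1 /\
      D^`().[t] = vdm_sqr s *
        \sum_(x <- s) w x * ((prodX s)^`()^`().[x] / (prodX s)^`().[x])).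
Proof.
move=> sg; have [f fE] := discriminant_of_coefs {poly F} n.
pose Q : {poly {poly F}} := p^:P - 'X%:P * g^:P.
pose c (P : {poly {poly F}}) (i : 'I_n) := (-1) ^+ i.+1 * P`_(n - i.+1).
exists f.@[c Q] => t s sn qs.
have modQ (M : {poly F}) (P r : {poly {poly F}}) : Q = P + M%:P * r ->
    exists k, f.@[c Q] = f.@[c P] + M * k.
  move=> eQ; have /dvdpP[k ek] : M %| f.@[c Q] - f.@[c P].
    apply: dvdp_meval_sub => i; rewrite /c -mulrBr dvdp_mull //.
    by rewrite -coefB eQ addrC addKr coefCM dvdp_mulr.
  by exists k; rewrite -[LHS](subrK f.@[c P]) ek addrC mulrC.
have eQt : Q = (prodX s)^:P - ('X - t%:P)%:P * g^:P.
  rewrite -qs /Q rmorphB /= -mul_polyC rmorphM /= map_polyC /= rmorphB /=; ring.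
split.
  have eqP : prodX (map polyC s) = (prodX s)^:P.
    by rewrite big_map map_prod_XsubC.
  have [|k ->] := modQ ('X - t%:P) (prodX (map polyC s)) (- g^:P).
    by rewrite eqP eQt mulrN.
  rewrite -fE ?size_map // vdm_sqr_map !hornerE.
  by rewrite subrr mul0r addr0.
move=> us w.
have ds x : x \in s -> (prodX s)^`().[x] != 0.
  by have := us; rewrite uniq_simple_roots => /allP; apply.
have sgs : (size g <= size s)%N by rewrite sn.
have [sw [r er]] := prod_first_order_interpolate t us sgs ds.
rewrite -/w sn in sw er; split => //.
have [|k ->] := modQ (('X - t%:P) ^+ 2) (prodX (first_order t w s)) (- r).
  by rewrite er eQt mulrN addrK.
rewrite -fE ?size_map //; have [_] := vdm_sqr_first_order t w us.
rewrite derivD hornerD => ->; rewrite derivM hornerD !hornerM expr2 derivM.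
rewrite hornerD !hornerM !hornerXsubC subrr !(mulr0, mul0r, addr0).
congr (_ * _); rewrite big_seq [RHS]big_seq; apply: eq_bigr => x xs.
by rewrite sum_inv_gaps.
Qed.

(** * Monotonicity of the discriminant of p - t p' *)

Lemma triple_rootE (F : numFieldType) (p : {poly F}) (x : F) : p != 0 ->
  (2 < mup x p)%N =
  [&& p.[x] == 0, p^`().[x] == 0 & p^`()^`().[x] == 0].
Proof.
move=> p0; rewrite mup_geq //; apply/idP/idP => [/dvdpP[k ->]|].
  rewrite !exprS expr0 mulr1 mulrC -!mulrA.
  rewrite !derivCXsubC !derivD !derivCXsubC !derivD !derivCXsubC.
  by rewrite !hornerD !hornerM !hornerXsubC subrr !mul0r !addr0 eqxx.
case/and3P=> /factor_theorem[g {p0}->]; rewrite [g * _]mulrC.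
rewrite !derivCXsubC derivD derivCXsubC.
rewrite !hornerD !hornerM !hornerXsubC subrr !mul0r !addr0.
move=> /factor_theorem[h ->]; rewrite [h * _]mulrC derivCXsubC.
rewrite !hornerD !hornerM !hornerXsubC subrr !mul0r !addr0 -mulr2n mulrn_eq0 /=.
move=> /factor_theorem[k ->]; apply/dvdpP; exists k; ring.
Qed.

(** At a multiple root of [p - t p'] one has [p = t p'] and [p' = t p''], hence
[p p'' = p'^2]. Strictness in the Laguerre inequality then forces [p] and [p']
to vanish, so [p''] vanishes as well and the root of [p] is at least triple. *)
Lemma uniq_roots_pencil (F : realFieldType) (r s : seq F) (t : F) :
  t != 0 -> (forall x, (mup x (prodX r) <= 2)%N) ->
  prodX r - t *: (prodX r)^`() = prodX s -> uniq s.
Proof.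
move=> t0 m2 qs; rewrite uniq_simple_roots; apply/allP => x xs.
have := root_prod_XsubC s x; rewrite xs /root -qs.
rewrite derivB derivZ !hornerE !subr_eq0 => /eqP q0.
apply/negP => /eqP q1.
have := m2 x; rewrite leqNgt triple_rootE ?monic_neq0 ?monic_prod_XsubC //.
have r0 : (0 < size r)%N.
  move: q0; case: (r) => //; rewrite !big_nil derivC hornerE horner0 mulr0.
  by move/eqP; rewrite oner_eq0.
case: (boolP (((prodX r).[x] != 0) || ((prodX r)^`().[x] != 0))).
  move=> /(laguerre_gt0 r0).
  by rewrite q0 {2}q1 -mulrA [_ * (_ * _)]mulrCA -q1 -expr2 ltxx.
rewrite negb_or !negbK => /andP[-> p1]; rewrite p1 /=.
by move: p1; rewrite q1 mulf_eq0 (negPf t0) => /= ->.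
Qed.

Lemma deriv_prod_XsubC_split (R : realType) (r : seq R) : (0 < size r)%N ->
  exists s, size s = (size r).-1 /\ (prodX r)^`() = (size r)%:R *: prodX s.
Proof.
move=> r0; set n := size r; have n0 : n%:R != 0 :> R by rewrite pnatr_eq0 -lt0n.
have sd : size (prodX r)^`() = n by rewrite polyorder.size_deriv size_prod_XsubC.
have lc : lead_coef (prodX r)^`() = n%:R.
  rewrite lead_coefE sd coef_deriv prednK //.
  have /monicP := monic_prod_XsubC r predT id.
  by rewrite lead_coefE size_prod_XsubC => ->.
have [||s es] := @real_rooted_split R (n%:R^-1 *: (prodX r)^`()).
- by rewrite monicE lead_coefZ lc mulVf.
- have := @real_rooted_pencil R r 0 (- n%:R^-1) r0.
  rewrite scale0r sub0r scaleNr opprK; apply.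
  by rewrite oppr_eq0 invr_eq0 n0 orbT.
exists s; split; last by rewrite -es scalerA divff // scale1r.
apply: succn_inj.
by rewrite -(size_prod_XsubC s id) -es size_scale ?invr_eq0 // sd prednK.
Qed.

Lemma laguerre_deriv_gt0 (R : realType) (r : seq R) (x : R)
    (p := prodX r) : (1 < size r)%N ->
    (p^`().[x] != 0) || (p^`()^`().[x] != 0) ->
  p^`().[x] * p^`()^`()^`().[x] < p^`()^`().[x] ^+ 2.
Proof.
move=> r1; have r0 := ltnW r1; have [s [ss ->]] := deriv_prod_XsubC_split r0.
have n0 : (size r)%:R != 0 :> R by rewrite pnatr_eq0 -lt0n.
rewrite !derivZ !hornerZ !mulf_eq0 !(negPf n0) /= => nz.
rewrite mulrACA -expr2 exprMn ltr_pM2l ?exprn_even_gt0 //.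
by apply: laguerre_gt0; rewrite // ss -subn1 subn_gt0.
Qed.

(** Here [a], [b], [c] stand for the first three derivatives of [p] at a root of
[q = p - t p'], so that [a - t b = q'] and [b - t c = q'']. The difference of
the two sides is [t^2 (b^2 - a c) / q'^2]. *)
Lemma weighted_log_deriv_gt (F : realFieldType) (t a b c : F) :
  t != 0 -> a - t * b != 0 -> a * c < b ^+ 2 ->
  a / (a - t * b) - 1 < t * (a / (a - t * b) * ((b - t * c) / (a - t * b))).
Proof.
move=> t0 d0 acb; rewrite -subr_gt0.
have -> : t * (a / (a - t * b) * ((b - t * c) / (a - t * b))) -
    (a / (a - t * b) - 1) = t ^+ 2 * (b ^+ 2 - a * c) / (a - t * b) ^+ 2.
  by field.
by rewrite divr_gt0 ?exprn_even_gt0 // mulr_gt0 ?subr_gt0 ?exprn_even_gt0.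
Qed.

Lemma monic_pencil (R : realType) (p : {poly R}) (t : R) :
  p \is monic ->
  p - t *: p^`() \is monic /\ size (p - t *: p^`()) = size p.
Proof.
move=> mp; have lt : (size (- (t *: p^`())) < size p)%N.
  rewrite size_polyN (leq_ltn_trans (size_scale_leq _ _)) //.
  by rewrite lt_size_deriv ?monic_neq0.
by rewrite monicE lead_coefDl ?size_polyDl // -monicE.
Qed.

(** With [w = p' / q'], the logarithmic derivative of [D] at [t], multiplied by
[t], is the sum of [t w q'' / q'] over the roots of [q]; it exceeds the sum of
[w - 1], which vanishes because the weights add up to the leading coefficient
of [p'], that is to the number of roots. *)
Lemma Dis_pencil_poly (R : realType) (r : seq R) (p := prodX r) :
    (1 < size r)%N -> (forall x, (mup x p <= 2)%N) ->
  exists D : {poly R},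
    (forall t, D.[t] = Dis (p - t *: p^`())) /\
    (forall t, t != 0 -> 0 < t * D^`().[t]).
Proof.
move=> r1 m2; set n := size r.
have sp : size p = n.+1 by rewrite size_prod_XsubC.
have sdp : size p^`() = n by rewrite polyorder.size_deriv sp.
have [D DE] := discriminant_of_pencil p (eq_leq sdp).
have split_q t : exists2 s, size s = n & p - t *: p^`() = prodX s.
  have [mq sq] := monic_pencil t (monic_prod_XsubC r predT id).
  have [|s es] := real_rooted_split mq.
    rewrite -[X in X - _]scale1r.
    by apply: real_rooted_pencil; rewrite ?oner_eq0 // ltnW.
  exists s => //; apply: succn_inj.
  by rewrite -(size_prod_XsubC s id) -es sq.
exists D; split=> [t|t t0]; have [s sn qs] := split_q t.
  by have [-> _] := DE t s sn qs; rewrite qs Dis_real_roots.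
have us := uniq_roots_pencil t0 m2 qs.
have [_ /(_ us) /= [sw ->]] := DE t s sn qs.
rewrite mulrCA mulr_gt0 ?vdm_sqr_gt0 // mulr_sumr.
have {}sw : \sum_(x <- s) (p^`().[x] / (prodX s)^`().[x] - 1) = 0.
  rewrite sumrB sw big_const_seq count_predT iter_addr_0 sn coef_deriv.
  rewrite prednK; last exact: ltnW.
  have /monicP := monic_prod_XsubC r predT id.
  by rewrite lead_coefE -/p sp /= => ->; rewrite subrr.
rewrite -[ltLHS]sw big_seq [ltRHS]big_seq; apply: ltr_sum.
  apply/hasP; exists s`_0; rewrite ?mem_nth // sn; exact: ltnW.
move=> x xs; have := us; rewrite uniq_simple_roots => /allP/(_ x xs).
rewrite -qs !(derivB, derivZ) !(hornerD, hornerN, hornerZ) => d0.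
apply: weighted_log_deriv_gt => //; apply: laguerre_deriv_gt0 => //.
apply: contraNT d0; rewrite negb_or !negbK => /andP[/eqP-> /eqP->].
by rewrite mulr0 subrr.
Qed.

Lemma Dis_size_le2 (R : realType) (p : {poly R}) :
  p \is monic -> (size p <= 2)%N -> Dis p = 1.
Proof.
move=> mp sp; apply: complexI; rewrite DisC //.
have : (size (complex_roots p) < 2)%N.
  by rewrite -(size_prod_XsubC _ id) -complex_rootsE // size_map_poly.
case: complex_roots => [|a []] //= _;
  by rewrite ?vdm_sqr_cons /vdm_sqr ?big_nil !big_ord0 ?mulr1.
Qed.

(** A root of [p] of multiplicity at least 3 is a multiple root of
[p - t p']. *)
Lemma Dis_pencil_triple_root (R : realType) (r : seq R) (x t : R)
    (p := prodX r) :
  (2 < mup x p)%N -> Dis (p - t *: p^`()) = 0.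
Proof.
move=> m3; have mp := monic_prod_XsubC r predT id.
have r0 : (0 < size r)%N.
  by move: m3; rewrite mu_prod_XsubC; case: (r).
have [mq _] := monic_pencil t mp.
have [|s qs] := real_rooted_split mq.
  by rewrite -[X in X - _]scale1r; apply: real_rooted_pencil; rewrite ?oner_eq0.
rewrite qs Dis_real_roots; apply/eqP; rewrite vdm_sqr_eq0 uniq_simple_roots.
move: m3; rewrite triple_rootE ?monic_neq0 // => /and3P[/eqP p0 /eqP p1 /eqP p2].
apply/allPn; exists x.
  by rewrite -root_prod_XsubC -qs /root !hornerE p0 p1 mulr0 subrr.
by rewrite negbK -qs derivB derivZ !hornerE p1 p2 mulr0 subrr.
Qed.

Lemma horner_lt_away_from0 (R : rcfType) (D : {poly R}) :
  (forall t, t != 0 -> 0 < t * D^`().[t]) ->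
  (forall a b : R, 0 <= a -> a < b -> D.[a] < D.[b]) /\
  (forall a b : R, a < b -> b <= 0 -> D.[b] < D.[a]).
Proof.
move=> hD; split=> a b.
  move=> a0 ab; have [c] := poly_mvt D ab; rewrite in_itv /= => /andP[ac cb] e.
  have c0 : 0 < c by exact: le_lt_trans ac.
  rewrite -subr_gt0 e mulr_gt0 ?subr_gt0 //.
  by rewrite -(pmulr_rgt0 _ c0) hD ?gt_eqF.
move=> ab b0; have [c] := poly_mvt D ab; rewrite in_itv /= => /andP[ac cb] e.
have c0 : c < 0 by exact: lt_le_trans b0.
rewrite -subr_lt0 e nmulr_rlt0 ?subr_gt0 //.
by rewrite -(nmulr_rgt0 _ c0) hD ?lt_eqF.
Qed.

Theorem theorem1p1 (R : realType) (d : nat) (p : {poly R}) (alpha : R)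
    (hmonic : p \is monic) (hdeg : size p = d.+1) (hreal : real_rooted p)
    (halpha : alpha != 0) :
  let D := fun t : R => Dis (p - (t * alpha) *: p^`()) in
  [/\ forall s t : R, s < t -> t < 0 -> D t <= D s,
      forall s t : R, 0 < s -> s < t -> D s <= D t,
      forall t : R, D 0 <= D t
    & (2 <= d)%N -> (forall x : R, (mup x p <= 2)%N) ->
      [/\ forall s t : R, s < t -> t < 0 -> D t < D s,
          forall s t : R, 0 < s -> s < t -> D s < D t
        & forall beta : R, beta != 0 -> Dis p < Dis (p - beta *: p^`())]].
Proof.
move=> D; have [r pr] := real_rooted_split hmonic hreal.
have szr : size r = d.
  by apply: succn_inj; rewrite -hdeg pr size_prod_XsubC.
have [d2|d2] := ltnP d 2.
  have D1 t : D t = 1.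
    have [mq sq] := monic_pencil (t * alpha) hmonic.
    by rewrite /D Dis_size_le2 // sq hdeg.
  by split=> [s t _ _|s t _ _|t|//]; rewrite !D1.
have [/hasP[x _ m3]|m2] := boolP (has (fun x => 2 < mup x p)%N r).
  have D0 t : D t = 0 by rewrite /D pr (@Dis_pencil_triple_root _ _ x) // -pr.
  split=> [s t _ _|s t _ _|t|_ /(_ x)]; rewrite ?D0 //.
  by rewrite leqNgt m3.
have {}m2 x : (mup x (prodX r) <= 2)%N.
  have [xr|xr] := boolP (x \in r); last first.
    by rewrite mu_prod_XsubC (count_memPn xr).
  by rewrite leqNgt -pr; apply: (hasPn m2).
have r2 : (1 < size r)%N by rewrite szr.
have [P [PE dP]] := Dis_pencil_poly r2 m2.
have {dP} [inc dec] := horner_lt_away_from0 dP.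
rewrite -pr in PE; have DE t : D t = P.[t * alpha] by rewrite PE.
have strict_neg s t : s < t -> t <= 0 -> D t < D s.
  move=> st t0; rewrite !DE; case: (ltrgtP alpha 0) halpha => // [an|ap] _.
    by apply: inc; rewrite ?mulr_le0 ?ltr_nM2r // ltW.
  by apply: dec; rewrite ?ltr_pM2r // mulr_le0_ge0 // ltW.
have strict_pos s t : 0 <= s -> s < t -> D s < D t.
  move=> s0 st; rewrite !DE; case: (ltrgtP alpha 0) halpha => // [an|ap] _.
    by apply: dec; rewrite ?ltr_nM2r // mulr_ge0_le0 // ltW.
  by apply: inc; rewrite ?ltr_pM2r // mulr_ge0 // ltW.
split=> [s t st t0|s t s0 st|t|_ _].
- by apply/ltW/strict_neg => //; exact: ltW.
- by apply/ltW/strict_pos => //; exact: ltW.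
- case: (ltrgtP t 0) => [t0|t0|->] //; apply: ltW; first exact: strict_neg.
  exact: strict_pos.
split=> [s t st t0|s t s0 st|b b0].
- by apply: strict_neg => //; exact: ltW.
- by apply: strict_pos => //; exact: ltW.
have -> : Dis p = P.[0] by rewrite PE scale0r subr0.
rewrite -PE; case: (ltrgtP b 0) b0 => // [bn|bp] _; [exact: dec|exact: inc].
Qed.
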